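(* Let $r\ge 1$ and let $P_1,P_2,\ldots,P_r\in\mathbb{C}[z]$ be polynomials such that $P_j-P_k$ is non-constant for any $j\neq k$. Let $d_j:=\deg(P_j)$ for $1\le j\le r$ and let $f_j:\mathbb{C}\to\mathbb{C}^*$, $f_j(z):=e^{P_j(z)}$ for all $z\in\mathbb{C}$, $1\le j\le r$. Then: (1) The holomorphic functions $f_1,\ldots,f_r$ are linearly independent over $\mathcal{M}_{<1}$. (2) If $d_j\ge 1$ for all $1\le j\le r$ and $|\{d_1,\ldots,d_r\}|=r$ (that is, the degrees are pairwise distinct), then $f_1,\ldots,f_r$ are algebraically independent over $\mathcal{M}_{<1}$.
   Context: An entire function $g$ has order of growth $\le\rho$ (for a real number $\rho>0$) if there are constants $A,B>0$ such that $|g(z)|\le Ae^{B|z|^{\rho}}$ for all $z\in\mathbb{C}$; its order of growth is $\rho(g)=\inf\{\rho>0 : g \text{ has order of growth}\le\rho\}$. $\mathcal{O}_{<1}$ denotes the domain of entire functions with order of growth $<1$, and $\mathcal{M}_{<1}$ denotes its quotient field, i.e. the field of meromorphic functions on $\mathbb{C}$ of order $<1$, viewed as a subfield of the field of all meromorphic functions on $\mathbb{C}$. *)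

(* Defs.v *)
From HB Require Import structures.
From mathcomp Require Import all_boot all_order all_algebra.
From mathcomp Require Import all_classical all_reals all_analysis.
From mathcomp Require Import generic_quotient ring_quotient complex.
(* The notations of mpoly clash with those of mathcomp-analysis. *)
From mathcomp Require Import -(notations) mpoly.

Set Implicit Arguments.
Unset Strict Implicit.
Unset Printing Implicit Defensive.

Import Order.TTheory GRing.Theory Num.Theory numFieldNormedType.Exports.
Local Open Scope classical_set_scope.
Local Open Scope ring_scope.
Local Open Scope quotient_scope.

(* Independence over a subset K of a commutative ring A; it is the usual notion
   when K is a subfield of a field contained in A. *)
Definition linearly_independent_over (A : comNzRingType) (K : set A) (r : nat)
    (f : 'I_r -> A) : Prop :=
  forall c : 'I_r -> A, (forall j, K (c j)) ->
    \sum_(j < r) c j * f j = 0 -> forall j, c j = 0.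

Definition algebraically_independent_over (A : comNzRingType) (K : set A)
    (r : nat) (f : 'I_r -> A) : Prop :=
  forall p : mpoly r A, (forall m, K (mcoeff m p)) ->
    meval f p = 0 -> p = 0.

Section EntireFunctions.
Variable R : realType.

(* Complex numbers as a normed space over themselves; derivability over this
   field is complex differentiability. *)
Local Notation C := (R[i]^o).

Definition entire (g : C -> C) : Prop := forall z : C, derivable g z 1.

(* The norm of R[i] takes values in R[i]. *)
Definition cmod (z : C) : R := complex.Re `|z|.

Definition expC (z : C) : C :=
  Complex (expR (complex.Re z) * cos (complex.Im z))
          (expR (complex.Re z) * sin (complex.Im z)).

Definition growth_le (rho : R) (g : C -> C) : Prop :=
  exists A B : R, [/\ 0 < A, 0 < B &
    forall z : C, cmod (g z) <= A * expR (B * (cmod z `^ rho))].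

(* The infimum is taken in the extended reals, so that a function with no
   growth exponent has order +oo. *)
Definition order_of_growth (g : C -> C) : \bar R :=
  ereal_inf [set rho%:E | rho in [set rho : R | 0 < rho /\ growth_le rho g]].

Definition O_lt1 : set (C -> C) :=
  [set g | entire g /\ (order_of_growth g < 1%:E)%E].

(* Functions vanishing off a set without accumulation point, i.e. off a closed
   discrete subset of the plane. *)
Definition codiscretely_zero : {pred (C -> C)} :=
  fun F => `[< forall z0 : C, \forall z \near z0^', F z = 0 >].

Lemma codiscretely_zeroP (F : C -> C) :
  reflect (forall z0 : C, \forall z \near z0^', F z = 0) (F \in codiscretely_zero).
Proof. exact: asboolP. Qed.

Lemma codiscretely_zero_idealr : idealr_closed codiscretely_zero.
Proof.
split.
- by apply/codiscretely_zeroP => z0; apply: nearW.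
- apply/negP => /codiscretely_zeroP /(_ 0) /filter_ex [z] /eqP.
  by rewrite oner_eq0.
- move=> a u v /codiscretely_zeroP uP /codiscretely_zeroP vP; apply/codiscretely_zeroP => z0.
  apply: filterS2 (uP z0) (vP z0) => z uz vz.
  by rewrite /GRing.add /GRing.mul /= uz vz mulr0 addr0.
Qed.

HB.instance Definition _ := isIdealr.Build (C -> C) codiscretely_zero codiscretely_zero_idealr.

(* Complex functions up to equality off a closed discrete set. A meromorphic
   function is identified with the class of any total function that agrees with
   it off its poles; the field of meromorphic functions on the plane thereby
   becomes a subring, so algebraic relations between meromorphic functions are
   equalities here. *)
Definition codiscrete_fun : comNzRingType := {ideal_quot codiscretely_zero}.

Definition fun_class (F : C -> C) : codiscrete_fun := \pi_({ideal_quot codiscretely_zero}) F.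

(* The zeros of h form a closed discrete set, so the value of g / h at these
   points is irrelevant. *)
Definition M_lt1 : set codiscrete_fun :=
  [set x | exists g h : C -> C,
     [/\ O_lt1 g, O_lt1 h, h != 0 & x = fun_class (fun z => g z / h z)]].

Definition exp_poly (P : {poly R[i]}) : C -> C := fun z => expC P.[z].

End EntireFunctions.

(* Main.v *)
Require Import Defs.
From mathcomp Require Import all_boot all_order all_algebra.
From mathcomp Require Import generic_quotient ring_quotient.
From mathcomp Require Import all_classical all_reals all_analysis.
From mathcomp Require Import complex ring lra.
From mathcomp Require Import -(notations) mpoly.

(** The idea is that a relation between exponentials makes coefficients small.
    After clearing denominators, suppose that the sum of [G_j * exp P_j] is zero,
    where the [G_j] are entire of order less than 1. At a point z where the real
    parts of the [P_j] are well separated, the term with the largest real part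
    is minus the sum of the others, so its coefficient is at most
    [exp (- eta |z|)] up to a factor [exp (e |z|)] with e arbitrarily small
    ([dominant_term_small]). The real part of a non-constant polynomial
    [P_j - P_k] is at least of the order of |z| outside narrow sectors, and these
    sectors can be avoided by a rotation: among the rotations of z by powers of a
    suitable root of -1, each pair (j, k) excludes at most one
    ([rotation_separation], [family_rotation_separation]). Hence the product of
    all rotations of all non-zero coefficients tends to 0 at infinity. By
    Liouville's theorem it is zero, but entire functions form an integral domain;
    so there is no non-zero coefficient ([exp_sum_independent]).

    The function theory needed is one estimate, [center_bound]: the modulus of an
    entire function at the centre of a circle is at most its supremum on the
    circle. It follows from Goursat's bisection, done on trapezoidal sums instead
    of integrals ([goursat]), in the coordinate w with [z = z0 + exp w], where
    periodicity makes two sides of a rectangle cancel. Liouville's theorem in the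
    form used is immediate ([liouville_zero]). The identity theorem follows by
    multiplying a function that vanishes on a half-plane by high powers of an
    exponential that is 1 at a given point and small on the part of a circle
    about it that leaves the half-plane ([vanish_half_plane_step],
    [identity_disk]).

    Algebraic independence reduces to linear independence: the monomials in the
    [exp P_j] are exponentials of combinations of the [P_j], and when the degrees
    are positive and distinct two different combinations differ by a non-constant
    polynomial ([size_combination]). *)

Set Implicit Arguments.
Unset Strict Implicit.
Unset Printing Implicit Defensive.

Import Order.TTheory GRing.Theory Num.Theory numFieldNormedType.Exports.
Local Open Scope classical_set_scope.
Local Open Scope ring_scope.

(** * The modulus, and entire functions *)

Section Modulus.
Variable R : realType.
Local Notation C := (R[i]^o).
Implicit Types z w : C.

Lemma cmodE z : cmod z = Num.sqrt (complex.Re z ^+ 2 + complex.Im z ^+ 2).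
Proof. by rewrite /cmod normc_def. Qed.

Lemma norm_cmod z : `|z| = (cmod z)%:C%C.
Proof. by rewrite /cmod normc_def. Qed.

Lemma cmod_ge0 z : 0 <= cmod z.
Proof. by rewrite cmodE sqrtr_ge0. Qed.

Lemma cmodM z w : cmod (z * w) = cmod z * cmod w.
Proof. by apply: (@complexI R); rewrite rmorphM /= -!norm_cmod normrM. Qed.

Lemma cmodD z w : cmod (z + w) <= cmod z + cmod w.
Proof. by rewrite -lecR rmorphD /= -!norm_cmod ler_normD. Qed.

Lemma cmod0 : cmod (0 : C) = 0.
Proof. by apply: (@complexI R); rewrite -norm_cmod normr0. Qed.

Lemma cmod1 : cmod (1 : C) = 1.
Proof. by apply: (@complexI R); rewrite -norm_cmod normr1. Qed.

Lemma cmodN z : cmod (- z) = cmod z.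
Proof. by rewrite /cmod normrN. Qed.

Lemma cmodB z w : cmod (z - w) = cmod (w - z).
Proof. by rewrite /cmod distrC. Qed.

Lemma cmod_eq0 z : (cmod z == 0) = (z == 0).
Proof. by rewrite -(inj_eq (@complexI R)) -norm_cmod normr_eq0. Qed.

Lemma cmod_gt0 z : (0 < cmod z) = (z != 0).
Proof. by rewrite lt_neqAle cmod_ge0 andbT eq_sym cmod_eq0. Qed.

Lemma cmodR (x : R) : cmod (x%:C%C : C) = `|x|.
Proof. by rewrite cmodE /= expr0n addr0 sqrtr_sqr. Qed.

Lemma cmod_half z : cmod (z / 2) = cmod z / 2.
Proof.
rewrite cmodM; congr (_ * _).
have -> : (2 : C)^-1 = (2^-1 : R)%:C%C.
  by rewrite rmorphV ?unitfE ?pnatr_eq0 //= rmorph_nat.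
by rewrite cmodR ger0_norm.
Qed.

Lemma cmodX z n : cmod (z ^+ n) = cmod z ^+ n.
Proof. by elim: n => [|n IH]; rewrite ?cmod1 // !exprS cmodM IH. Qed.

Lemma cmod_prod (I : finType) (Q : pred I) (F : I -> C) :
  cmod (\prod_(i | Q i) F i) = \prod_(i | Q i) cmod (F i).
Proof. exact: (big_morph _ cmodM cmod1). Qed.

Lemma cmod_sum (I : finType) (Q : pred I) (F : I -> C) :
  cmod (\sum_(i | Q i) F i) <= \sum_(i | Q i) cmod (F i).
Proof.
apply: (big_ind2 (fun x y => cmod x <= y)) => //; first by rewrite cmod0.
by move=> x x' y y' h h'; apply: le_trans (cmodD _ _) (lerD h h').
Qed.

Lemma Re_le_cmod z : `|complex.Re z| <= cmod z.
Proof. by rewrite cmodE -sqrtr_sqr ler_wsqrtr // lerDl sqr_ge0. Qed.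

Lemma Im_le_cmod z : `|complex.Im z| <= cmod z.
Proof. by rewrite cmodE -sqrtr_sqr ler_wsqrtr // lerDr sqr_ge0. Qed.

Lemma cmod_le_ReIm z : cmod z <= `|complex.Re z| + `|complex.Im z|.
Proof.
rewrite cmodE -[leRHS]ger0_norm ?addr_ge0 // -sqrtr_sqr ler_wsqrtr //.
by rewrite sqrrD !real_normK ?num_real // -addrA lerD2l lerDr mulrn_wge0 // mulr_ge0.
Qed.

Lemma near_cmodP (z0 : C) (Q : C -> Prop) :
  (\forall z \near z0, Q z) <->
  exists2 d : R, 0 < d & forall z, cmod (z - z0) < d -> Q z.
Proof.
split.
  move=> /nbhs_ballP [e /= e0 He].
  move: (e0); rewrite ltcE /= => /andP[/eqP ime ree].
  exists (complex.Re e) => // z zd; apply: He.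
  rewrite -ball_normE /= distrC norm_cmod.
  by rewrite ltcE /= ime eqxx.
move=> [d d0 Hd]; apply/nbhs_ballP; exists (d%:C)%C => /=.
  by rewrite ltcR.
by move=> z; rewrite -ball_normE /= distrC norm_cmod ltcR => /Hd.
Qed.

Lemma dnear_cmodP (z0 : C) (Q : C -> Prop) :
  (\forall z \near z0^', Q z) <->
  exists2 d : R, 0 < d & forall z, z != z0 -> cmod (z - z0) < d -> Q z.
Proof.
split => [|[d d0 H]].
  by move=> /near_cmodP [d d0 H]; exists d => // z zz zd; apply: H.
by apply/near_cmodP; exists d => // z zd zz; apply: H.
Qed.

(** Complex differentiability with real tolerances: this spares the estimates
    below the order of R[i], in which moduli of R[i] are compared. *)
Definition cderiv (g : C -> C) (z0 L : C) := forall e : R, 0 < e ->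
  exists2 d : R, 0 < d & forall z, cmod (z - z0) < d ->
    cmod (g z - g z0 - L * (z - z0)) <= e * cmod (z - z0).

Lemma derivable_cderiv (g : C -> C) z0 : derivable g z0 1 -> exists L, cderiv g z0 L.
Proof.
move=> /cvg_ex [L HL]; exists L => e e0.
move/cvgrPdist_le : HL => /(_ (e%:C)%C).
rewrite ltcR => /(_ e0) /dnear_cmodP [d d0 Hd]; exists d => // z zd.
have [->|zz] := eqVneq z z0; first by rewrite !subrr mulr0 subrr cmod0 mulr0.
have /Hd : z - z0 != 0 by rewrite subr_eq0.
rewrite subr0 => /(_ zd).
rewrite norm_cmod lecR => H.
have nz : 0 < cmod (z - z0) by rewrite cmod_gt0 subr_eq0.
rewrite -(ler_pM2r nz) -cmodM in H; apply: le_trans H.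
rewrite le_eqVlt; apply/orP; left; apply/eqP; rewrite -cmodN; congr cmod.
rewrite /= [_%:A]mulr1 subrK [_ *: _]mulrC mulrBl divfK ?subr_eq0//.
by rewrite opprB.
Qed.

Lemma cderiv_derivable (g : C -> C) z0 L : cderiv g z0 L -> derivable g z0 1.
Proof.
move=> HL; apply/cvg_ex; exists L; apply/cvgrPdist_le => e e0.
have [ime ree] : complex.Im e = 0 /\ 0 < complex.Re e.
  by move: e0; rewrite ltcE /= => /andP[/eqP].
have [d d0 Hd] := HL _ ree.
apply/dnear_cmodP; exists d => // h h0; rewrite subr0 => hd.
have := Hd (h + z0); rewrite addrK => /(_ hd) H.
have nz : 0 < cmod h by rewrite cmod_gt0.
rewrite norm_cmod lecE /= ime eqxx /= -(ler_pM2r nz) -cmodM.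
apply: le_trans H; rewrite le_eqVlt; apply/orP; left; apply/eqP; rewrite -cmodN; congr cmod.
by rewrite /= [_%:A]mulr1 [_ *: _]mulrC mulrBl divfK// opprB.
Qed.

(** The bridge between the limit of difference quotients that defines [entire]
    and the first-order expansions on which the estimates are made. *)
Lemma entireP (g : C -> C) : entire g <-> forall z, exists L, cderiv g z L.
Proof.
split=> H z; first exact: derivable_cderiv.
by have [L /cderiv_derivable] := H z.
Qed.

Lemma entire_cst c : entire (fun=> c : C).
Proof. by move=> z; apply: derivable_cst. Qed.

Lemma entire_id : entire (fun z : C => z).
Proof. by move=> z; apply: derivable_id. Qed.

Lemma entireD (f g : C -> C) : entire f -> entire g -> entire (fun z => f z + g z).
Proof. by move=> ef eg z; apply: derivableD (ef z) (eg z). Qed.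

Lemma entireM (f g : C -> C) : entire f -> entire g -> entire (fun z => f z * g z).
Proof. by move=> ef eg z; apply: derivableM (ef z) (eg z). Qed.

Lemma entire_comp (f g : C -> C) : entire f -> entire g -> entire (fun z => f (g z)).
Proof.
move=> ef eg z; apply/derivable1_diffP; apply: differentiable_comp.
  exact/derivable1_diffP.
exact/derivable1_diffP.
Qed.

Lemma entire_sum (I : finType) (Q : pred I) (F : I -> C -> C) :
  (forall i, entire (F i)) -> entire (fun z => \sum_(i | Q i) F i z).
Proof.
move=> eF; elim: (index_enum I) => [|i s IH].
  by under eq_fun do rewrite big_nil; exact: entire_cst.
under eq_fun do rewrite big_cons.
case: (Q i) => /=; last exact: IH.
exact: (@entireD (F i) (fun z => _) (eF i) IH).
Qed.

Lemma entire_prod (I : finType) (Q : pred I) (F : I -> C -> C) :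
  (forall i, entire (F i)) -> entire (fun z => \prod_(i | Q i) F i z).
Proof.
move=> eF; elim: (index_enum I) => [|i s IH].
  by under eq_fun do rewrite big_nil; exact: entire_cst.
under eq_fun do rewrite big_cons.
case: (Q i) => /=; last exact: IH.
exact: (@entireM (F i) (fun z => _) (eF i) IH).
Qed.

Lemma entire_horner (P : {poly R[i]}) : entire (fun z : C => P.[z] : C).
Proof.
elim/poly_ind: P => [|P c IH].
  rewrite (_ : (fun _ => _) = fun=> 0); first exact: entire_cst.
  by apply/funext => z; rewrite horner0.
rewrite (_ : (fun _ => _) = fun z : C => (P.[z] : C) * z + (c : C)).
  apply: (@entireD (fun z => P.[z] * z) (fun=> c)); last exact: entire_cst.
  exact: (@entireM (fun z => P.[z]) id IH entire_id).
by apply/funext => z; rewrite hornerMXaddC.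
Qed.

End Modulus.

(** * The complex exponential *)

Section Exponential.
Variable R : realType.
Local Notation C := (R[i]^o).
Implicit Types z w : C.

Lemma expCD z w : expC (z + w) = expC z * expC w.
Proof.
case: z w => [a b] [c d]; rewrite /expC /=; apply/eqP; rewrite eq_complex /=.
by rewrite expRD cosD sinD; apply/andP; split; apply/eqP; ring.
Qed.

Lemma expC0 : expC (0 : C) = 1.
Proof. by rewrite /expC /= expR0 cos0 sin0 mulr1 mulr0. Qed.

Lemma expCX z n : expC (z *+ n) = expC z ^+ n.
Proof. by elim: n => [|n IH]; rewrite ?mulr0n ?expC0// mulrS exprS expCD IH. Qed.

Lemma cmod_expC z : cmod (expC z) = expR (complex.Re z).
Proof.
by rewrite cmodE /= !exprMn -mulrDr cos2Dsin2 mulr1 sqrtr_sqr ger0_norm ?expR_ge0.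
Qed.

Lemma expC_neq0 z : expC z != 0.
Proof. by rewrite -cmod_gt0 cmod_expC expR_gt0. Qed.

Lemma expC_periodic z : expC (z + Complex 0 (pi *+ 2)) = expC z.
Proof. by case: z => a b; rewrite /expC /= addr0 cosD2pi sinD2pi. Qed.

(** The bound on the imaginary part lets a circle be parametrised by a compact
    interval. *)
Lemma expC_surj z : z != 0 -> exists2 w : C, `|complex.Im w| <= pi & expC w = z.
Proof.
rewrite -cmod_gt0 => z0; set r := cmod z in z0.
have rn : r != 0 by rewrite gt_eqF.
set a := complex.Re z; set b := complex.Im z.
have ab : (a / r) ^+ 2 + (b / r) ^+ 2 = 1.
  rewrite !expr_div_n -mulrDl /r cmodE sqr_sqrtr ?divff //.
    by rewrite -[X in X != 0]sqr_sqrtr ?addr_ge0 ?sqr_ge0// -cmodE expf_neq0.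
  by rewrite addr_ge0 ?sqr_ge0.
have b1 : -1 <= a / r <= 1.
  rewrite -ler_norml -(@ler_pXn2r _ 2) ?nnegrE// expr1n real_normK ?num_real//.
  by rewrite -ab lerDl sqr_ge0.
pose t := if 0 <= b then acos (a / r) else - acos (a / r).
exists (Complex (ln r) t) => /=.
  have tb : `|acos (a / r)| <= pi by rewrite ger0_norm ?acos_ge0 ?acos_lepi.
  by rewrite /t; case: ifP => _; rewrite ?normrN.
rewrite /expC /= lnK ?posrE//.
have ct : cos t = a / r.
  by rewrite /t; case: ifP => _; rewrite ?cosN acosK.
have st : sin t = b / r.
  have e : 1 - (a / r) ^+ 2 = (b / r) ^+ 2 by rewrite -ab addrC addKr.
  rewrite /t; case: ifPn => [b0|]; rewrite ?sinN sin_acos// e sqrtr_sqr.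
    by rewrite ger0_norm // divr_ge0 // ltW.
  rewrite -ltNge => b0; rewrite ltr0_norm ?opprK //.
  by rewrite pmulr_llt0 ?invr_gt0.
by rewrite ct st !(mulrC r) !divfK //; apply/eqP; rewrite eq_complex /= !eqxx.
Qed.

Lemma is_derive_eps (f : R -> R) (x l : R) : is_derive x 1 f l ->
  forall e, 0 < e -> exists2 d, 0 < d &
  forall h, `|h| < d -> `|f (x + h) - f x - l * h| <= e * `|h|.
Proof.
move=> df e e0.
have /cvg_ex [l' Hl] : derivable f x 1 by exact: ex_derive.
have ll : l' = l by rewrite -(derive_val (is_derive := df)) /derive; apply/esym/cvg_lim.
rewrite {}ll in Hl.
move/cvgrPdist_le : Hl => /(_ _ e0) [d /= d0 Hd]; exists d => // h hd.
have [->|h0] := eqVneq h 0; first by rewrite addr0 mulr0 !subrr normr0 mulr0.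
have := Hd h; rewrite /= sub0r normrN => /(_ hd h0).
rewrite [_%:A]mulr1 -(ler_pM2r (_ : 0 < `|h|)) ?normr_gt0 // -normrM.
rewrite [_ *: _]mulrC mulrBl divfK // distrC (addrC h).
by [].
Qed.

(** By the addition formula, differentiability at 0 is enough; there it reduces
    to the real expansions of exp, cos and sin at 0. *)
Lemma cderiv_expC0 : cderiv (@expC R) 0 1.
Proof.
move=> e e0.
have [e' [e'0 e'1 e'e]] : exists e', [/\ 0 < e', e' <= 1 & e' <= e / 8].
  exists (Num.min (e / 8) 1).
  by rewrite lt_min !ge_min !lexx orbT divr_gt0 ?ltr01.
have [d1 d10 H1] := is_derive_eps (is_derive_expR 0) e'0.
have [d2 d20 H2] := is_derive_eps (is_derive_cos 0) e'0.
have [d3 d30 H3] := is_derive_eps (is_derive_sin 0) e'0.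
exists (Num.min (Num.min d1 d2) (Num.min d3 e')); first by rewrite !lt_min d10 d20 d30 e'0.
move=> [x y]; rewrite subr0 !lt_min -!andbA => /and4P[l1 l2 l3 l4].
have xl := Re_le_cmod (Complex x y : C); have yl := Im_le_cmod (Complex x y : C).
rewrite /= in xl yl; set m := cmod _ in l1 l2 l3 l4 xl yl *.
have := H1 x (le_lt_trans xl l1); rewrite add0r expR0 mul1r => h1.
have := H2 y (le_lt_trans yl l2); rewrite add0r cos0 sin0 oppr0 mul0r subr0 => h2.
have := H3 y (le_lt_trans yl l3); rewrite add0r sin0 cos0 mul1r subr0 => h3.
apply: le_trans (cmod_le_ReIm _) _.
have -> : complex.Re (expC (Complex x y : C) - expC 0 - 1 * Complex x y) =
   expR x * cos y - 1 - x.
  by rewrite expC0 mul1r.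
have -> : complex.Im (expC (Complex x y : C) - expC 0 - 1 * Complex x y) =
   expR x * sin y - y.
  by rewrite expC0 mul1r /= subr0.
have c1 : `|cos y| <= 1 by rewrite ler_norml cos_geN1 cos_le1.
have m0 : 0 <= m by exact: cmod_ge0.
have -> : expR x * cos y - 1 - x = (expR x - 1 - x) * cos y + (1 + x) * (cos y - 1).
  by ring.
have -> : expR x * sin y - y = (expR x - 1 - x) * sin y + x * sin y + (sin y - y).
  by ring.
have s1 : `|sin y| <= 1 by rewrite ler_norml sin_geN1 sin_le1.
have s2 : `|sin y| <= 2 * m.
  have -> : sin y = (sin y - y) + y by ring.
  apply: le_trans (ler_normD _ _) _.
  have : e' * `|y| <= 1 * m by rewrite ler_pM // ltW.
  lra.
have A1 : `|(expR x - 1 - x) * cos y| <= e' * m.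
  rewrite normrM -[leRHS]mulr1 ler_pM //; apply: le_trans h1 _.
  by rewrite ler_wpM2l // ltW.
have A2 : `|(1 + x) * (cos y - 1)| <= 2 * (e' * m).
  rewrite normrM ler_pM //.
    by apply: le_trans (ler_normD _ _) _; rewrite normr1; lra.
  by apply: le_trans h2 _; rewrite ler_wpM2l // ltW.
have A3 : `|(expR x - 1 - x) * sin y| <= e' * m.
  rewrite normrM -[leRHS]mulr1 ler_pM //; apply: le_trans h1 _.
  by rewrite ler_wpM2l // ltW.
have A4 : `|x * sin y| <= 2 * (e' * m).
  rewrite normrM; have -> : 2 * (e' * m) = e' * (2 * m) by ring.
  by rewrite ler_pM // ltW // (le_lt_trans xl).
have A5 : `|sin y - y| <= e' * m.
  by apply: le_trans h3 _; rewrite ler_wpM2l // ltW.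
have A6 : e' * m <= (e * m) / 8 by rewrite mulrAC ler_wpM2r.
have A7 : 0 <= e * m by rewrite mulr_ge0 // ltW.
have := ler_normD ((expR x - 1 - x) * cos y) ((1 + x) * (cos y - 1)).
have := ler_normD ((expR x - 1 - x) * sin y + x * sin y) (sin y - y).
have := ler_normD ((expR x - 1 - x) * sin y) (x * sin y).
lra.
Qed.

Lemma entire_expC : entire (@expC R).
Proof.
apply/entireP => z; exists (expC z) => e e0.
have m0 : 0 < cmod (expC z) by rewrite cmod_gt0 expC_neq0.
have [d d0 Hd] := cderiv_expC0 (divr_gt0 e0 m0).
exists d => // w wd.
have := Hd (w - z); rewrite subr0 => /(_ wd) H.
have -> : expC w - expC z - expC z * (w - z) =
    expC z * (expC (w - z) - expC 0 - 1 * (w - z)).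
  have -> : expC w = expC z * expC (w - z) by rewrite -expCD addrC subrK.
  by rewrite expC0; ring.
rewrite cmodM mulrC -ler_pdivlMr // (le_trans H) //.
by rewrite mulrAC.
Qed.

(** The chart w |-> a + exp w turns the circles about a into vertical lines on
    which functions are periodic; both the bound at the centre of a disk and
    the identity theorem are proved in it. *)
Lemma entire_exp_chart (g : C -> C) a :
  entire g -> entire (fun w => g (a + expC w)).
Proof.
move=> eg.
have ez := @entireD R (fun=> a) (@expC R) (@entire_cst R a) entire_expC.
exact: (@entire_comp R g (fun w => a + expC w) eg ez).
Qed.

End Exponential.

(** * Goursat's bisection and the bound at the centre of a disk *)

Section Goursat.
Variable R : realType.
Local Notation C := (R[i]^o).
Implicit Types (p u v z w : C) (h : C -> C).

(** Twice the composite trapezoidal approximation, with [2 ^ n] steps, of the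
    integral of h along the segment from p to p + u. For these finite
    sums additivity under halving holds by definition. *)
Fixpoint edge_sum (n : nat) h p u : C :=
  if n is m.+1 then edge_sum m h p (u / 2) + edge_sum m h (p + u / 2) (u / 2)
  else u * (h p + h (p + u)).

Definition boundary_sum n h p u v : C :=
  edge_sum n h p u + edge_sum n h (p + u) v
  - edge_sum n h (p + v) u - edge_sum n h p v.

(** Halving both sides of a parallelogram: the sums over interior edges
    cancel. *)
Lemma boundary_sumS n h p u v : boundary_sum n.+1 h p u v =
  boundary_sum n h p (u / 2) (v / 2) + boundary_sum n h (p + u / 2) (u / 2) (v / 2)
  + (boundary_sum n h (p + v / 2) (u / 2) (v / 2)
     + boundary_sum n h (p + u / 2 + v / 2) (u / 2) (v / 2)).
Proof.
have half (x : C) : x / 2 + x / 2 = x by rewrite -splitr.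
have cu : p + u / 2 + u / 2 = p + u by rewrite -addrA half.
have cv : p + v / 2 + v / 2 = p + v by rewrite -addrA half.
have cuv : p + u / 2 + v / 2 + u / 2 = p + u + v / 2 by rewrite -[in RHS](half u); ring.
have cuv' : p + u / 2 + v / 2 + v / 2 = p + v + u / 2 by rewrite -[in RHS](half v); ring.
have cc : p + v / 2 + u / 2 = p + u / 2 + v / 2 by ring.
rewrite /boundary_sum /= cu cv cc cuv cuv'; ring.
Qed.

Lemma edge_sum_le n h p u (M : R) :
  (forall s : R, 0 <= s <= 1 -> cmod (h (p + s%:C%C * u)) <= M) ->
  cmod (edge_sum n h p u) <= 2 * cmod u * M.
Proof.
elim: n p u => [|n IH] p u H /=.
  rewrite cmodM -mulrA mulrCA ler_wpM2l ?cmod_ge0 //.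
  apply: le_trans (cmodD _ _) _.
  have := H 0; rewrite lexx ler01 mul0r addr0 => /(_ isT).
  have := H 1; rewrite lexx ler01 mul1r => /(_ isT).
  lra.
apply: le_trans (cmodD _ _) _.
have e (s : R) : s%:C%C * (u / 2) = (s / 2)%:C%C * u :> C.
  by rewrite rmorphM /= rmorphV ?unitfE ?pnatr_eq0 //= rmorph_nat; ring.
have h1 : u / 2 = (2^-1 : R)%:C%C * u.
  by rewrite rmorphV ?unitfE ?pnatr_eq0 //= rmorph_nat mulrC.
have A1 := IH p (u / 2); have A2 := IH (p + u / 2) (u / 2); rewrite cmod_half in A1 A2.
have -> : 2 * cmod u * M = 2 * (cmod u / 2) * M + 2 * (cmod u / 2) * M.
  by rewrite -mulrDl -mulrDr -splitr.
apply: lerD; [apply: A1 => s hs| apply: A2 => s hs].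
  by rewrite e; apply: H; lra.
rewrite e h1 -addrA -mulrDl -rmorphD /=; apply: H; lra.
Qed.

Lemma edge_sumD n (f g : C -> C) p u :
  edge_sum n (fun z => f z + g z) p u = edge_sum n f p u + edge_sum n g p u.
Proof.
elim: n p u => [|n IH] p u /=; first by rewrite -mulrDr; congr (_ * _); ring.
by rewrite !IH; ring.
Qed.

(** The trapezoidal rule is exact on affine functions, so their sums around a
    closed contour vanish. *)
Lemma edge_sum_affine n (a b : C) p u :
  edge_sum n (fun z => a + b * z) p u = u * (2 * a + b * (2 * p + u)).
Proof.
elim: n p u => [|n IH] p u /=; first by ring.
by rewrite !IH; field.
Qed.

(** Near a point of differentiability the affine part contributes nothing and
    the remainder is at most a small multiple of the diameter; the length of
    the boundary gives the second factor. *)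
Lemma goursat_local h z0 L (c : R) : cderiv h z0 L -> 0 < c ->
  exists2 d : R, 0 < d & forall p u v,
    (exists s t : R, [/\ 0 <= s <= 1, 0 <= t <= 1 & z0 = p + s%:C%C * u + t%:C%C * v]) ->
    cmod u + cmod v < d ->
    forall n, cmod (boundary_sum n h p u v) <= c * (cmod u + cmod v) ^+ 2.
Proof.
move=> hL c0; have [d d0 Hd] := hL _ (divr_gt0 c0 (ltr0Sn R 3)).
exists d => // p u v [s [t [s01 t01 z0E]]] uvd n.
set D := cmod u + cmod v in uvd *.
have D0 : 0 <= D by rewrite addr_ge0 ?cmod_ge0.
pose k z := h z - h z0 - L * (z - z0).
have kE m q w : edge_sum m h q w = edge_sum m k q w
    + w * (2 * (h z0 - L * z0) + L * (2 * q + w)).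
  rewrite -(edge_sum_affine m) -edge_sumD; congr edge_sum.
  by apply/funext => z; rewrite /k; ring.
have -> : boundary_sum n h p u v = boundary_sum n k p u v.
  by rewrite /boundary_sum !kE; ring.
have kb (s' t' : R) : 0 <= s' <= 1 -> 0 <= t' <= 1 ->
    cmod (k (p + s'%:C%C * u + t'%:C%C * v)) <= c / 4 * D.
  move=> s'1 t'1; set z := _ + _ + _.
  have zz : cmod (z - z0) <= D.
    have -> : z - z0 = (s' - s)%:C%C * u + (t' - t)%:C%C * v.
      by rewrite z0E /z !rmorphB /=; ring.
    apply: le_trans (cmodD _ _) _; rewrite !cmodM !cmodR.
    apply: lerD; rewrite ler_piMl ?cmod_ge0 // ler_norml; lra.
  apply: le_trans (Hd _ (le_lt_trans zz uvd)) _.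
  by rewrite ler_wpM2l // divr_ge0 // ltW.
have k1 : cmod (edge_sum n k p u) <= 2 * cmod u * (c / 4 * D).
  by apply: edge_sum_le => x x1; have := kb x 0 x1; rewrite mul0r addr0; apply; lra.
have k2 : cmod (edge_sum n k (p + u) v) <= 2 * cmod v * (c / 4 * D).
  by apply: edge_sum_le => x x1; have := kb 1 x _ x1; rewrite mul1r; apply; lra.
have k3 : cmod (edge_sum n k (p + v) u) <= 2 * cmod u * (c / 4 * D).
  by apply: edge_sum_le => x x1; have := kb x 1 x1; rewrite mul1r addrAC; apply; lra.
have k4 : cmod (edge_sum n k p v) <= 2 * cmod v * (c / 4 * D).
  by apply: edge_sum_le => x x1; have := kb 0 x _ x1; rewrite mul0r addr0; apply; lra.
have -> : c * D ^+ 2 = 2 * cmod u * (c / 4 * D) + 2 * cmod v * (c / 4 * D) +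
  2 * cmod u * (c / 4 * D) + 2 * cmod v * (c / 4 * D) by rewrite /D; field.
rewrite /boundary_sum; apply: le_trans (cmodD _ _) _; rewrite cmodN lerD //.
apply: le_trans (cmodD _ _) _; rewrite cmodN lerD //.
by apply: le_trans (cmodD _ _) _; rewrite lerD //.
Qed.

Lemma half_pow_small (D d : R) : 0 < d -> exists k : nat, D * 2^-1 ^+ k < d.
Proof.
move=> d0; exists (Num.bound (D / d)).
rewrite exprVn ltr_pdivrMr ?exprn_gt0 // mulrC -ltr_pdivrMr //.
exact: upper_nthrootP.
Qed.

(** Nested dyadic intervals, each the left or the right half of the previous one,
    have a common point. *)
Lemma dyadic_limit (a : nat -> R) :
  (forall k, a k.+1 = a k \/ a k.+1 = a k + 2^-1 ^+ k.+1) ->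
  exists l, forall k, a k <= l <= a k + 2^-1 ^+ k.
Proof.
move=> aS; have p0 k : 0 < 2^-1 ^+ k :> R by rewrite exprn_gt0 // invr_gt0.
have pS k : 2^-1 ^+ k = 2^-1 ^+ k.+1 + 2^-1 ^+ k.+1 :> R by rewrite exprS; field.
have lo : {homo a : m n / (m <= n)%N >-> m <= n}.
  apply: homo_leq => [//|x y z|k]; first exact: le_trans.
  by case: (aS k) => ->; rewrite ?lexx // lerDl ltW.
have up : {homo (fun k => a k + 2^-1 ^+ k) : m n / (m <= n)%N >-> n <= m}.
  apply: homo_leq => [//|x y z xy yz|k]; first exact: le_trans xy.
  by have := p0 k.+1; rewrite (pS k); case: (aS k) => ->; lra.
have ub k j : a j <= a k + 2^-1 ^+ k.
  apply: le_trans (lo _ _ (leq_maxr k j)) _.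
  apply: le_trans (up _ _ (leq_maxl k j)).
  by rewrite lerDl ltW.
exists (sup (range a)) => k; apply/andP; split.
  apply: ub_le_sup; last by exists k.
  by exists (a k + 2^-1 ^+ k) => _ [j _ <-].
apply: ge_sup; first by exists (a 0), 0.
by move=> _ [j _ <-].
Qed.

(** Cauchy's theorem for finite sums, by Goursat's bisection: were the bound
    to fail, it would fail on one of the four half-size parallelograms and so
    on a nested sequence of them, against the local estimate at their common
    point. The bound is relative to the square of the size because this is
    what four quarters add up to. *)
Lemma goursat h p u v (c : R) : entire h -> 0 < c ->
  exists N, forall n, (N <= n)%N ->
    cmod (boundary_sum n h p u v) <= c * (cmod u + cmod v) ^+ 2.
Proof.
move=> hh c0; apply: contrapT => bad0.
pose good q a b := exists N, forall n, (N <= n)%N ->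
    cmod (boundary_sum n h q a b) <= c * (cmod a + cmod b) ^+ 2.
have good_split q a b : good q (a / 2) (b / 2) -> good (q + a / 2) (a / 2) (b / 2) ->
    good (q + b / 2) (a / 2) (b / 2) -> good (q + a / 2 + b / 2) (a / 2) (b / 2) ->
    good q a b.
  move=> [N1 H1] [N2 H2] [N3 H3] [N4 H4].
  exists (maxn (maxn N1 N2) (maxn N3 N4)).+1 => -[//|n]; rewrite ltnS.
  rewrite !geq_max -!andbA => /and4P[/H1 h1 /H2 h2 /H3 h3 /H4 h4].
  rewrite boundary_sumS; rewrite !cmod_half in h1 h2 h3 h4.
  apply: le_trans (cmodD _ _) _; apply: le_trans (lerD (cmodD _ _) (cmodD _ _)) _.
  have -> : c * (cmod a + cmod b) ^+ 2 = 4 * (c * (cmod a / 2 + cmod b / 2) ^+ 2) by field.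
  lra.
pose half k : R := 2^-1 ^+ k.
(* Being good is inherited from quarters; [cell k x] is the cell of the
   [k]-th dyadic subdivision whose lower corner has coordinates x. *)
pose cell k (x : R * R) := good (p + x.1%:C%C * u + x.2%:C%C * v)
   ((half k)%:C%C * u) ((half k)%:C%C * v).
have half2 k (x : C) : (half k)%:C%C * x / 2 = (half k.+1)%:C%C * x.
  by rewrite /half exprS rmorphM rmorphV ?unitfE ?pnatr_eq0 //= rmorph_nat; ring.
have step kx : exists y : R * R, ~ cell kx.1 kx.2 -> [/\ ~ cell kx.1.+1 y,
    (y.1 = kx.2.1 \/ y.1 = kx.2.1 + half kx.1.+1) &
    (y.2 = kx.2.2 \/ y.2 = kx.2.2 + half kx.1.+1)].
  case: kx => k [s t] /=; apply: contrapT => /forallNP noy.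
  have bad : ~ cell k (s, t) by have /not_implyP[] := noy (s, t).
  apply: bad; rewrite /cell /=.
  have sub y : (y.1 = s \/ y.1 = s + half k.+1) -> (y.2 = t \/ y.2 = t + half k.+1) ->
      cell k.+1 y.
    move=> y1 y2; apply: contrapT => bad; apply: (noy y) => _; split=> //.
  have goodE q q' a b : good q a b -> q = q' -> good q' a b by move=> ? <-.
  apply: good_split; rewrite !half2.
  - exact: (sub (s, t) (or_introl erefl) (or_introl erefl)).
  - apply: goodE (sub (s + half k.+1, t) (or_intror erefl) (or_introl erefl)) _.
    by rewrite /= rmorphD /=; ring.
  - apply: goodE (sub (s, t + half k.+1) (or_introl erefl) (or_intror erefl)) _.
    by rewrite /= rmorphD /=; ring.
  - apply: goodE (sub (s + half k.+1, t + half k.+1) (or_intror erefl) (or_intror erefl)) _.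
    by rewrite /= !rmorphD /=; ring.
have [nxt nxtP] := choice step.
pose x := fix x k : R * R := if k is j.+1 then nxt (j, x j) else (0, 0).
have xbad k : ~ cell k (x k).
  elim: k => [|k IH].
    by rewrite /cell /= !mul0r !addr0 /half expr0 !mul1r.
  by have [] := nxtP (k, x k) IH.
have [ls lsP] : exists l, forall k, (x k).1 <= l <= (x k).1 + 2^-1 ^+ k.
  by apply: dyadic_limit => k; have [] := nxtP (k, x k) (xbad k).
have [lt ltP] : exists l, forall k, (x k).2 <= l <= (x k).2 + 2^-1 ^+ k.
  by apply: dyadic_limit => k; have [] := nxtP (k, x k) (xbad k).
pose z0 : C := p + ls%:C%C * u + lt%:C%C * v.
have [L hL] : exists L, cderiv h z0 L by exact: ((entireP h).1 hh z0).
have [d d0 Hd] := goursat_local hL c0.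
have [k kd] := half_pow_small (cmod u + cmod v) d0.
have h0 : 0 < half k by rewrite exprn_gt0 // invr_gt0.
apply: (xbad k); exists 0 => n _; apply: Hd; last first.
  by rewrite !cmodM cmodR ger0_norm ?ltW // -mulrDr mulrC.
exists ((ls - (x k).1) / half k), ((lt - (x k).2) / half k); split.
- have /andP[l1 l2] := lsP k; rewrite divr_ge0 ?subr_ge0 ?(ltW h0)//=.
  by rewrite ler_pdivrMr // mul1r lerBlDl.
- have /andP[l1 l2] := ltP k; rewrite divr_ge0 ?subr_ge0 ?(ltW h0)//=.
  by rewrite ler_pdivrMr // mul1r lerBlDl.
- rewrite ![_%:C%C * (_ * _)]mulrA -!rmorphM /= !divfK ?gt_eqF //.
  by rewrite /z0 !rmorphB /=; ring.
Qed.

Lemma entire_continuous h z0 (e : R) : entire h -> 0 < e ->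
  exists2 d : R, 0 < d & forall z, cmod (z - z0) < d -> cmod (h z - h z0) <= e.
Proof.
move=> /entireP /(_ z0) [L hL] e0; have [d d0 Hd] := hL 1 ltr01.
have m0 : 0 < 1 + cmod L by rewrite ltr_wpDr ?cmod_ge0.
exists (Num.min d (e / (1 + cmod L))); first by rewrite lt_min d0 divr_gt0.
move=> z; rewrite lt_min => /andP[zd ze].
have -> : h z - h z0 = (h z - h z0 - L * (z - z0)) + L * (z - z0) by rewrite subrK.
apply: le_trans (cmodD _ _) _; rewrite cmodM.
apply: (@le_trans _ _ ((1 + cmod L) * cmod (z - z0))).
  by rewrite mulrDl lerD2r Hd.
by rewrite mulrC -ler_pdivlMr // ltW.
Qed.

(** In the chart w |-> z0 + exp w, take the rectangle of height [2 * pi]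
    between the circle of radius r and a circle so small that g is nearly
    constant on it. By periodicity the horizontal sides cancel, so the sums
    over the two circles nearly agree, and the inner one is about
    [2 * (2 * pi * i) * g z0]. *)
Theorem center_bound g z0 (r M : R) : entire g -> 0 < r ->
  (forall z, cmod (z - z0) = r -> cmod (g z) <= M) -> cmod (g z0) <= M.
Proof.
move=> eg r0 gM; apply/ler_addgt0Pr => e e0.
have [d d0 Hd] := entire_continuous z0 eg (divr_gt0 e0 (ltr0Sn R 1)).
pose h (w : C) := g (z0 + expC w).
have eh : entire h := @entire_exp_chart R g z0 eg.
pose v : C := Complex 0 (pi *+ 2).
have cv : cmod v = pi *+ 2.
  by rewrite cmodE /= expr0n add0r sqrtr_sqr ger0_norm // mulrn_wge0 // pi_ge0.
have cv0 : 0 < cmod v by rewrite cv pmulrn_rgt0 // pi_gt0.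
pose p : C := Complex (ln (d / 2)) 0; pose u : C := Complex (ln r - ln (d / 2)) 0.
have ReD (q : C) s : complex.Re (q + s%:C%C * v) = complex.Re q.
  by case: q => a b /=; ring.
have d20 : 0 < d / 2 by rewrite divr_gt0.
pose D := cmod u + cmod v.
have D0 : 0 < D by rewrite ltr_wpDl ?cmod_ge0.
have c0 : 0 < e * cmod v / D ^+ 2 by rewrite divr_gt0 ?mulr_gt0 ?exprn_gt0.
have [n /(_ n (leqnn n))] := goursat p u v eh c0.
rewrite -/D divfK ?gt_eqF ?exprn_gt0 // => Hn.
have hv n' q w : edge_sum n' h (q + v) w = edge_sum n' h q w.
  elim: n' q w => [|n' IH] q w /=; last by rewrite -[q + v + _]addrAC !IH.
  by rewrite /h -[q + v + _]addrAC !expC_periodic.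
have bE : boundary_sum n h p u v = edge_sum n h (p + u) v - edge_sum n h p v.
  by rewrite /boundary_sum hv; ring.
rewrite {}bE in Hn.
have outer : cmod (edge_sum n h (p + u) v) <= 2 * cmod v * M.
  apply: edge_sum_le => s _; apply: gM; rewrite addrC addKr cmod_expC ReD /=.
  by rewrite addrC subrK lnK.
have inner : cmod (edge_sum n (fun w => h w + - g z0) p v) <= 2 * cmod v * (e / 2).
  apply: edge_sum_le => s _; apply: Hd; rewrite addrC addKr cmod_expC ReD /=.
  by rewrite lnK // ltr_pdivrMr // ltr_pMr // ltr1n.
have innerE : edge_sum n h p v = edge_sum n (fun w => h w + - g z0) p v + 2 * v * g z0.
  have -> : 2 * v * g z0 = v * (2 * g z0 + 0 * (2 * p + v)) by ring.
  rewrite -(edge_sum_affine n) -edge_sumD; congr edge_sum.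
  by apply/funext => w; rewrite mul0r addr0 subrK.
have -> : cmod (g z0) = cmod (2 * v * g z0) / (2 * cmod v).
  rewrite !cmodM; have -> : cmod (2 : C) = 2.
    by have := @cmodR R 2; rewrite rmorph_nat ger0_norm.
  by rewrite [_ * cmod (g z0)]mulrC mulfK // mulf_neq0 // ?gt_eqF // pnatr_eq0.
rewrite ler_pdivrMr ?mulr_gt0 //.
have -> : 2 * v * g z0 = edge_sum n h (p + u) v -
   (edge_sum n h (p + u) v - edge_sum n h p v) -
   edge_sum n (fun w => h w + - g z0) p v by rewrite innerE; ring.
apply: le_trans (cmodD _ _) _; rewrite cmodN.
apply: le_trans (lerD (cmodD _ _) (lexx _)) _; rewrite cmodN.
have -> : (M + e) * (2 * cmod v) = 2 * cmod v * M + e * cmod v + 2 * cmod v * (e / 2).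
  by field.
by rewrite !lerD.
Qed.

End Goursat.

(** * The identity theorem and Liouville's theorem *)

Section Identity.
Variable R : realType.
Local Notation C := (R[i]^o).
Implicit Types (z w : C) (f g h : C -> C).

Lemma bounded_on_circle h w0 : entire h ->
  exists M : R, forall w, cmod (w - w0) = 1 -> cmod (h w) <= M.
Proof.
move=> eh; pose k (w : C) := h (w0 + expC w).
have ek : entire k := @entire_exp_chart R h w0 eh.
pose q (t : R) := cmod (k (Complex 0 t)).
have cq : continuous q.
  move=> t; apply/cvgrPdist_le => e e0.
  have [d d0 Hd] := entire_continuous (Complex 0 t) ek e0.
  exists d => //= t'; rewrite /= => td.
  have : cmod (k (Complex 0 t') - k (Complex 0 t)) <= e.
    apply: Hd; apply: le_lt_trans (cmod_le_ReIm _) _.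
    by rewrite /= subr0 normr0 add0r distrC.
  apply: le_trans; rewrite /q ler_norml.
  have h1 := cmodD (k (Complex 0 t') - k (Complex 0 t)) (k (Complex 0 t)).
  have h2 := cmodD (k (Complex 0 t) - k (Complex 0 t')) (k (Complex 0 t')).
  rewrite subrK in h1; rewrite subrK cmodB in h2; lra.
have pp : - pi <= pi :> R by have := pi_gt0 R; lra.
have [c _ cM] := EVT_max pp (continuous_subspaceT cq).
exists (q c) => w w1.
have w0w : w - w0 != 0 by rewrite -cmod_gt0 w1 ltr01.
have [[a b] /= bp] := expC_surj w0w; move=> E.
have a0 : a = 0.
  by have := cmod_expC (Complex a b : C); rewrite E w1 /= -expR0 => /expR_inj.
have -> : h w = k (Complex 0 b) by rewrite /k -a0 E addrC subrK.
by apply: cM; rewrite in_itv /= -ler_norml.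
Qed.

(** Multiply h by the n-th power of [E w = exp (- (w - w0) + (w - w0) ^ 2 / 2)].
    This does not change the value at w0, and on the unit circle about w0 the
    modulus of E is below 1 wherever the real part of [w - w0] is at least
    [- 3 / 10]; on the rest of the circle h vanishes. So the bound at the
    centre decays exponentially in n. *)
Lemma vanish_half_plane_step h (s : R) : entire h ->
  (forall w, complex.Re w <= s -> h w = 0) ->
  forall w, complex.Re w <= s + 3 / 10 -> h w = 0.
Proof.
move=> eh hs w0 w0s.
have [M HM] := bounded_on_circle w0 eh.
pose phi (w : C) : C := - (w - w0) + (w - w0) * ((w - w0) / 2).
have ephi : entire phi.
  pose Q : {poly R[i]} := 'X - w0%:P.
  rewrite (_ : phi = fun w => (- Q + Q * (Q * (2^-1)%:P)).[w]); first exact: entire_horner.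
  by apply/funext => w; rewrite /Q /phi !(hornerD, hornerN, hornerM, hornerC, hornerX).
have RePhi d : complex.Re (- d + d * (d / 2) : C) =
    - complex.Re d + (complex.Re d ^+ 2 - complex.Im d ^+ 2) / 2.
  have -> : d / 2 = (2^-1 : R)%:C%C * d.
    by rewrite rmorphV ?unitfE ?pnatr_eq0 //= rmorph_nat mulrC.
  by case: d => x y /=; ring.
pose E (w : C) := expC (phi w).
have eE : entire E by exact: (@entire_comp R (@expC R) phi (@entire_expC R) ephi).
have Hn n : cmod (h w0) * (1 + n%:R / 10) <= M.
  pose g w := h w * \prod_(i < n) E w.
  have eg : entire g.
    exact: (@entireM R h _ eh (@entire_prod R 'I_n xpredT (fun=> E) (fun=> eE))).
  have gw0 : g w0 = h w0.
    by rewrite /g /E /phi subrr mul0r oppr0 addr0 expC0 big1 // mulr1.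
  have gb : forall w, cmod (w - w0) = 1 -> cmod (g w) <= M * expR (- (n%:R / 10)).
    move=> w w1; have [ws|ws] := lerP (complex.Re w) s.
      rewrite /g (hs _ ws) mul0r cmod0 mulr_ge0 ?expR_ge0 //.
      exact: le_trans (cmod_ge0 _) (HM _ w1).
    rewrite /g cmodM ler_pM ?cmod_ge0 ?HM // cmod_prod.
    rewrite prodr_const card_ord cmod_expC -expRM_natl ler_expR -mulr_natl.
    rewrite -mulrN ler_wpM2l //.
    have : (cmod (w - w0)) ^+ 2 = 1 by rewrite w1 expr1n.
    rewrite cmodE sqr_sqrtr ?addr_ge0 ?sqr_ge0 //.
    rewrite /phi RePhi.
    have : complex.Re (w - w0) = complex.Re w - complex.Re w0 by case: (w) (w0) => ? ? [].
    set x := complex.Re (w - w0); set y := complex.Im _ => xE xy.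
    (* With x ^ 2 + y ^ 2 = 1 the exponent is x ^ 2 - x - 1 / 2, which is at most
       - 11 / 100 on the interval from - 3 / 10 to 1. *)
    have : x <= 1 by rewrite -w1 (le_trans (ler_norm _) (Re_le_cmod _)).
    nra.
  have := center_bound eg ltr01 gb; rewrite gw0 expRN ler_pdivlMr ?expR_gt0 //.
  by apply: le_trans; rewrite ler_wpM2l ?cmod_ge0 // expR_ge1Dx.
apply/eqP; rewrite -cmod_eq0 eq_le cmod_ge0 andbT leNgt; apply/negP => h0.
have := Hn (Num.bound (10 * M / cmod (h w0))); set n := Num.bound _.
have : 10 * M / cmod (h w0) < n%:R by exact: unstable.ltr_bound.
rewrite ltr_pdivrMr //; nra.
Qed.

Lemma vanish_half_plane h (s : R) : entire h ->
  (forall w, complex.Re w <= s -> h w = 0) -> forall w, h w = 0.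
Proof.
move=> eh hs w.
have H n : forall w, complex.Re w <= s + n%:R * (3 / 10) -> h w = 0.
  elim: n => [|n IH] w'; first by rewrite mul0r addr0; exact: hs.
  move=> w's; apply: (vanish_half_plane_step eh IH).
  by move: w's; rewrite -natr1; lra.
have h1 : (complex.Re w - s) / (3 / 10) < (Num.bound ((complex.Re w - s) / (3 / 10)))%:R.
  exact: unstable.ltr_bound.
apply: (H (Num.bound ((complex.Re w - s) / (3 / 10)))).
rewrite ltr_pdivrMr // in h1; lra.
Qed.

(** In the chart w |-> a + exp w a disk about a becomes a half-plane. *)
Theorem identity_disk f a (d : R) : entire f -> 0 < d ->
  (forall z, cmod (z - a) < d -> f z = 0) -> forall z, f z = 0.
Proof.
move=> ef d0 fd z; have [->|za] := eqVneq z a.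
  by apply: fd; rewrite subrr cmod0.
pose h (w : C) := f (a + expC w).
have eh : entire h := @entire_exp_chart R f a ef.
have [w _ wE] : exists2 w : C, `|complex.Im w| <= pi & expC w = z - a.
  by apply: expC_surj; rewrite subr_eq0.
have -> : f z = h w by rewrite /h wE addrC subrK.
apply: (@vanish_half_plane h (ln (d / 2)) eh) => w' w's.
apply: fd; rewrite addrC addKr cmod_expC.
have d2 : 0 < d / 2 by rewrite divr_gt0.
have : expR (complex.Re w') <= d / 2 by rewrite -(lnK d2) ler_expR.
by move/le_lt_trans; apply; rewrite ltr_pdivrMr // ltr_pMr // ltr1n.
Qed.

Lemma identity_dnear f a : entire f -> (\forall z \near a^', f z = 0) -> forall z, f z = 0.
Proof.
move=> ef /dnear_cmodP [d d0 Hd].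
have c2 : cmod ((d / 2)%:C%C : C) = d / 2 by rewrite cmodR ger0_norm // ltW // divr_gt0.
apply: (@identity_disk f (a + (d / 2)%:C%C) (d / 2) ef); first by rewrite divr_gt0.
move=> z zd; apply: Hd.
  apply: contraTneq zd => ->.
  by rewrite opprD addrA subrr add0r cmodN c2 ltxx.
have -> : z - a = (z - (a + (d / 2)%:C%C)) + (d / 2)%:C%C by rewrite opprD; ring.
apply: le_lt_trans (cmodD _ _) _; rewrite c2; lra.
Qed.

Lemma entire_mul_neq0 f g : entire f -> entire g ->
  (exists z, f z != 0) -> (exists z, g z != 0) -> exists z, f z * g z != 0.
Proof.
move=> ef eg [z0 f0] [z1 g1]; apply: contrapT => /forallNP H.
move/negP : g1; apply; apply/eqP.
have m0 : 0 < cmod (f z0) by rewrite cmod_gt0.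
have [d d0 Hd] := entire_continuous z0 ef (divr_gt0 m0 (ltr0Sn R 1)).
apply: (@identity_disk g z0 d eg d0) => z /Hd fz.
have /negP := H z; rewrite negbK mulf_eq0 => /orP[/eqP fz0|/eqP //].
exfalso; move: fz; rewrite fz0 sub0r cmodN; lra.
Qed.

Lemma entire_prod_neq0 (I : finType) (Q : pred I) (F : I -> C -> C) :
  (forall i, entire (F i)) -> (forall i, Q i -> exists z, F i z != 0) ->
  exists z, \prod_(i | Q i) F i z != 0.
Proof.
move=> eF F0.
have eP s : entire (fun z => \prod_(i <- s | Q i) F i z).
  elim: s => [|i s IH].
    by under eq_fun do rewrite big_nil; exact: entire_cst.
  under eq_fun do rewrite big_cons.
  case: (Q i) => /=; last exact: IH.
  exact: (@entireM R (F i) (fun z => _) (eF i) IH).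
elim: (index_enum I) => [|i s IH]; first by exists 0; rewrite big_nil oner_eq0.
have [z] : exists z, (if Q i then F i z * \prod_(i <- s | Q i) F i z
   else \prod_(i <- s | Q i) F i z) != 0.
  case: (boolP (Q i)) => [Qi|_]; last exact: IH.
  by apply: (@entire_mul_neq0 (F i) (fun z => \prod_(i <- s | Q i) F i z)); auto.
by move=> Hz; exists z; rewrite big_cons.
Qed.

Theorem liouville_zero f : entire f ->
  (forall e : R, 0 < e -> exists r : R, forall z, r <= cmod z -> cmod (f z) <= e) ->
  forall z, f z = 0.
Proof.
move=> ef H z; apply/eqP; rewrite -cmod_eq0 eq_le cmod_ge0 andbT.
apply/ler_addgt0Pr => e e0; rewrite add0r; have [r Hr] := H e e0.
have r0 : 0 < `|r| + cmod z + 1 by rewrite ltr_wpDl ?addr_ge0 ?cmod_ge0.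
apply: (center_bound ef r0) => w wE; apply: Hr.
have := cmodD w (- z); rewrite wE cmodN.
have := ler_norm r; have := cmod_ge0 z; lra.
Qed.

End Identity.

(** * Separation of real parts by rotations *)

Section Separation.
Variable R : realType.
Local Notation C := (R[i]^o).
Implicit Types (z w : C).

Lemma fin_pos_lower (I : finType) (f : I -> R) : (forall i, 0 < f i) ->
  exists2 s, 0 < s & forall i, s <= f i.
Proof.
move=> f0; pose T := 1 + \sum_i (f i)^-1.
have T0 : 0 < T by rewrite ltr_wpDr // sumr_ge0 // => i _; rewrite invr_ge0 ltW.
exists T^-1; first by rewrite invr_gt0.
move=> i; rewrite invf_ple ?posrE // /T (bigD1 i) //= addrCA lerDl addr_ge0 //.
by rewrite sumr_ge0 // => j _; rewrite invr_ge0 ltW.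
Qed.

Lemma fin_upper (I : finType) (f : I -> R) :
  exists2 s, 0 <= s & forall i, f i <= s.
Proof.
exists (\sum_i `|f i|); first exact: sumr_ge0.
move=> i; apply: le_trans (ler_norm _) _; rewrite (bigD1 i) //= lerDl.
exact: sumr_ge0.
Qed.

(** An N-th root of -1: none of its powers of exponent between 1 and [N - 1] is
    real, which is what makes it a useful rotation. *)
Definition root_minus1 (N : nat) : C := expC (Complex 0 (pi / N%:R)).

Lemma cmod_root_minus1 N : cmod (root_minus1 N) = 1.
Proof. by rewrite cmod_expC /= expR0. Qed.

Lemma Im_root_minus1X N n : (0 < n < N)%N -> complex.Im (root_minus1 N ^+ n) != 0.
Proof.
move=> /andP[n0 nN]; rewrite -expCX.
have -> : (Complex 0 (pi / N%:R) : C) *+ n = Complex 0 (pi * (n%:R / N%:R)).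
  have -> : (Complex 0 (pi / N%:R) : C) *+ n = Complex 0 ((pi / N%:R) *+ n).
    elim: n {n0 nN} => [|n IH]; first by rewrite !mulr0n.
    by rewrite !mulrSr IH; apply/eqP; rewrite eq_complex /= addr0 !eqxx.
  by rewrite -mulr_natr mulrAC mulrA.
rewrite /= expR0 mul1r gt_eqF // sin_gt0_pi //.
have N0 : 0 < N%:R :> R by rewrite ltr0n (leq_trans _ nN).
rewrite mulr_gt0 ?divr_gt0 ?pi_gt0 ?ltr0n ?(leq_trans _ nN) //=.
by rewrite gtr_pMr ?pi_gt0 // ltr_pdivrMr // mul1r ltr_nat.
Qed.

Lemma poly_leading (Q : {poly R[i]}) d : size Q = d.+2 ->
  exists2 K : R, 0 <= K & forall z, 1 <= cmod z ->
    cmod (Q.[z] - lead_coef Q * z ^+ d.+1) <= K * cmod z ^+ d.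
Proof.
move=> sQ; exists (\sum_(i < d.+1) cmod Q`_i).
  by apply: sumr_ge0 => i _; exact: cmod_ge0.
move=> z z1; rewrite horner_coef sQ big_ord_recr /= lead_coefE sQ /= addrK mulr_suml.
apply: le_trans (@cmod_sum R 'I_d.+1 xpredT (fun i => Q`_i * z ^+ i)) _.
apply: ler_sum => i _; rewrite cmodM cmodX ler_wpM2l ?cmod_ge0 //.
by rewrite ler_weXn2l // -ltnS.
Qed.

(** Write [a] for the leading term of Q at one rotation of z; at the other it
    is [a * t] with t of modulus 1 and not real. If [a] and [a * t] both had a
    small real part, then so would [a] its imaginary part. Hence one of the two
    real parts is comparable to the modulus of [a], which dominates the other
    terms of Q. *)
Lemma rotation_separation (Q : {poly R[i]}) (m N : nat) : (1 < size Q)%N ->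
  (m * size Q <= N)%N ->
  exists2 eta : R, 0 < eta & exists r0 : R, forall z, r0 <= cmod z ->
  forall k l : nat, (k < l < m)%N ->
    eta * cmod z <= `|complex.Re (Q.[root_minus1 N ^+ k * z])| \/
    eta * cmod z <= `|complex.Re (Q.[root_minus1 N ^+ l * z])|.
Proof.
case sQ: (size Q) => [//|[//|d]] _ mN.
have [K K0 HK] := poly_leading sQ.
have [s s0 Hs] : exists2 s : R, 0 < s & forall n, (0 < n < N)%N ->
    s <= `|complex.Im (root_minus1 N ^+ n)|.
  have [i|s s0 Hs] := @fin_pos_lower 'I_N
      (fun n => if (0 < n)%N then `|complex.Im (root_minus1 N ^+ n)| else 1).
    by case: ifP => // i0; rewrite normr_gt0 Im_root_minus1X // i0 /=.
  exists s => // n /andP[n0 nN].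
  by have := Hs (Ordinal nN); rewrite /= n0.
pose q : C := lead_coef Q.
have q0 : 0 < cmod q by rewrite cmod_gt0 lead_coef_eq0 -size_poly_eq0 sQ.
have s20 : 0 < 1 + 2 / s by rewrite ltr_wpDr // divr_ge0 // ltW.
have [kap kap0 kapE] : exists2 kap, 0 < kap & kap * (1 + 2 / s) = cmod q.
  by exists (cmod q / (1 + 2 / s)); rewrite ?divr_gt0 // divfK // gt_eqF.
exists (kap / 2); first by rewrite divr_gt0.
exists (1 + 2 * K / kap) => z zr k l /andP[kl lm].
have Kk : 0 <= 2 * K / kap by rewrite divr_ge0 ?mulr_ge0 // ltW.
have z1 : 1 <= cmod z by lra.
have z2 : 2 * K / kap <= cmod z by lra.
have cu n : cmod (root_minus1 N ^+ n) = 1 by rewrite cmodX cmod_root_minus1 expr1n.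
have cz n : cmod (root_minus1 N ^+ n * z) = cmod z by rewrite cmodM cu mul1r.
(* It suffices to bound the real part of the leading term below. *)
have lead n : kap * cmod z ^+ d.+1 <= `|complex.Re (q * (root_minus1 N ^+ n * z) ^+ d.+1)| ->
    kap / 2 * cmod z <= `|complex.Re (Q.[root_minus1 N ^+ n * z])|.
  set a := q * _ => Ha.
  have := HK (root_minus1 N ^+ n * z); rewrite cz => /(_ z1).
  rewrite -/q -/a => /(le_trans (Re_le_cmod _)).
  have -> : complex.Re (Q.[root_minus1 N ^+ n * z] - a) =
      complex.Re (Q.[root_minus1 N ^+ n * z]) - complex.Re a by case: (_.[_]) (a) => ? ? [].
  rewrite distrC => /(le_trans (lerB_dist _ _)) H.
  have h1 : K * cmod z ^+ d <= kap / 2 * cmod z ^+ d.+1.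
    rewrite exprS mulrA ler_wpM2r ?exprn_ge0 ?cmod_ge0 //.
    by move: z2; rewrite ler_pdivrMr //; lra.
  have h2 : kap / 2 * cmod z <= kap / 2 * cmod z ^+ d.+1.
    by rewrite ler_wpM2l ?divr_ge0 ?(ltW kap0)// -[leLHS]expr1 ler_weXn2l.
  lra.
suff : kap * cmod z ^+ d.+1 <= `|complex.Re (q * (root_minus1 N ^+ k * z) ^+ d.+1)| \/
       kap * cmod z ^+ d.+1 <= `|complex.Re (q * (root_minus1 N ^+ l * z) ^+ d.+1)|.
  by case=> /lead; [left|right].
set a := q * (root_minus1 N ^+ k * z) ^+ d.+1; pose t := root_minus1 N ^+ ((l - k) * d.+1).
have -> : q * (root_minus1 N ^+ l * z) ^+ d.+1 = a * t.
  rewrite /a /t -[in LHS](subnK (ltnW kl)) exprD exprM !exprMn; ring.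
have st : s <= `|complex.Im t|.
  apply: Hs; rewrite muln_gt0 subn_gt0 kl /=.
  apply: leq_trans mN; rewrite -sQ sQ.
  apply: (@leq_ltn_trans ((l - k) * d.+2)); first by rewrite leq_mul2l leqnSn orbT.
  by rewrite ltn_pmul2r // (leq_ltn_trans (leq_subr _ _)).
have t1 : cmod t = 1 by exact: cu.
have aE : cmod a = cmod q * cmod z ^+ d.+1 by rewrite cmodM cmodX cz.
have ReM : complex.Re (a * t) =
    complex.Re a * complex.Re t - complex.Im a * complex.Im t by case: (a) (t) => ? ? [].
apply: contrapT => /not_orP[/negP]; rewrite -ltNge => h1 /negP; rewrite -ltNge => h2.
set x := kap * _ in h1 h2.
have h3 : `|complex.Im a| * s < 2 * x.
  apply: (@le_lt_trans _ _ `|complex.Im a * complex.Im t|).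
    by rewrite normrM ler_wpM2l.
  have -> : complex.Im a * complex.Im t = complex.Re a * complex.Re t - complex.Re (a * t).
    by rewrite ReM; ring.
  apply: le_lt_trans (ler_normB _ _) _; rewrite normrM.
  have : `|complex.Re a| * `|complex.Re t| <= `|complex.Re a| * 1.
    by rewrite ler_wpM2l // -t1 Re_le_cmod.
  lra.
have h4 : `|complex.Im a| < 2 * x / s by rewrite ltr_pdivlMr.
have := cmod_le_ReIm a; rewrite aE.
have -> : cmod q * cmod z ^+ d.+1 = x * (1 + 2 / s).
  by rewrite /x mulrAC kapE.
rewrite mulrDr mulr1 mulrCA mulrA; lra.
Qed.

End Separation.

(** * Linear independence with entire coefficients *)

Section ExpSum.
Variable R : realType.
Local Notation C := (R[i]^o).
Implicit Types (z w : C).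

(** Minimal exponential type: this is what order less than 1 contributes to the
    argument, in a form that is visibly stable under products. *)
Definition minimal_type (g : C -> C) := forall e : R, 0 < e ->
  exists c : R, forall z, cmod (g z) <= c * expR (e * cmod z).

(** Pigeonhole: each pair (i, j) spoils at most one of the m rotations of z, and
    there are more rotations than pairs. *)
Lemma family_rotation_separation (I : finType) (P : I -> {poly R[i]}) :
  (forall i j, i != j -> (1 < size (P i - P j)%R)%N) ->
  exists (m N : nat) (eta r0 : R), 0 < eta /\ forall z, r0 <= cmod z ->
  exists k : 'I_m, forall i j, i != j ->
    eta * cmod z <= `|complex.Re ((P i - P j).[root_minus1 R N ^+ k * z])|.
Proof.
move=> hP; pose m := #|{: I * I}|.+1.
pose N := (m * (\sum_(p : I * I) size (P p.1 - P p.2)%R))%N.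
have sep p : exists er : R * R, 0 < er.1 /\ (p.1 != p.2 ->
   forall z, er.2 <= cmod z -> forall k l : nat, (k < l < m)%N ->
    er.1 * cmod z <= `|complex.Re ((P p.1 - P p.2).[root_minus1 R N ^+ k * z])| \/
    er.1 * cmod z <= `|complex.Re ((P p.1 - P p.2).[root_minus1 R N ^+ l * z])|).
  have [pE|pN] := eqVneq p.1 p.2; first by exists (1, 0); split; rewrite ?ltr01.
  have mN : (m * size (P p.1 - P p.2)%R <= N)%N.
    by rewrite leq_mul2l /= (bigD1 p) //= leq_addr.
  have [eta e0 [r0 Hr]] := rotation_separation (hP _ _ pN) mN.
  by exists (eta, r0).
have [er erP] := choice sep.
have [eta e0 He] := @fin_pos_lower _ _ (fun p => (er p).1) (fun p => (erP p).1).
have [r0 _ Hr] := @fin_upper _ _ (fun p => (er p).2).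
exists m, N, eta, r0; split=> // z zr; apply: contrapT => /forallNP bad.
have bad' (k : 'I_m) : exists p : I * I, p.1 != p.2 /\
    `|complex.Re ((P p.1 - P p.2).[root_minus1 R N ^+ k * z])| < eta * cmod z.
  apply: contrapT => /forallNP nob; apply: (bad k) => i j ij.
  by rewrite leNgt; apply/negP => lt; apply: (nob (i, j)).
have [f fP] := choice bad'.
suff /leq_card : injective f by rewrite card_ord ltnn.
have main (k l : 'I_m) : f k = f l -> (k < l)%N -> False.
  move=> fkl kl; have [fk1 fk2] := fP k; have [_ fl2] := fP l.
  have lm : (k < l < m)%N by rewrite kl ltn_ord.
  have := (erP (f k)).2 fk1 z (le_trans (Hr _) zr) k l lm.
  have h : eta * cmod z <= (er (f k)).1 * cmod z by rewrite ler_wpM2r ?cmod_ge0.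
  rewrite -fkl in fl2.
  by case=> /(le_trans h); rewrite leNgt ?fk2 ?fl2.
move=> k l fkl; apply/val_inj; apply/eqP; rewrite eqn_leq.
by apply/andP; split; rewrite leqNgt; apply/negP; [apply: (main l k)|apply: (main k l)].
Qed.

(** The term whose exponential is largest at z is minus the sum of the others,
    and their exponentials are smaller by a factor of at least [expR x]. *)
Lemma dominant_term_small (I : finType) (P : I -> {poly R[i]}) (G : I -> C -> C)
    (x T : R) z : 0 <= x -> 0 <= T ->
  (forall i j, i != j -> x <= `|complex.Re (P i - P j).[z]|) ->
  (forall i, cmod (G i z) <= T) ->
  \sum_i G i z * expC (P i).[z] = 0 ->
  forall (S : pred I) i0, S i0 -> (forall i, ~~ S i -> G i z = 0) ->
  exists2 i, S i & cmod (G i z) <= #|I|%:R * T * expR (- x).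
Proof.
move=> x0 T0 sep GT sum0 S i0 Si0 nS.
pose f i := complex.Re (P i).[z].
have ReB i j : complex.Re (P i - P j).[z] = f i - f j.
  by rewrite hornerD hornerN /f; case: (_.[_]) (_.[_]) => ? ? [].
pose i := [arg max_(i > i0 | S i) f i]%O.
have [Si imax] : S i /\ forall j, S j -> f j <= f i.
  by rewrite /i; case: Order.TotalTheory.arg_maxP => // j Sj jmax.
exists i => //.
have GE : G i z = - \sum_(j | j != i) G j z * expC ((P j).[z] - (P i).[z] : C).
  have e1 : expC ((P i).[z] : C) * expC (- (P i).[z] : C) = 1.
    by rewrite -expCD subrr expC0.
  apply/eqP; rewrite -addr_eq0; apply/eqP.
  transitivity ((\sum_i G i z * expC (P i).[z]) * expC (- (P i).[z] : C)); last first.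
    by rewrite sum0 mul0r.
  rewrite [in RHS](bigD1 i) //= mulrDl -mulrA e1 mulr1; congr (_ + _).
  by rewrite mulr_suml; apply: eq_bigr => j _; rewrite -mulrA expCD.
rewrite GE cmodN; apply: le_trans (cmod_sum _ _) _.
apply: (@le_trans _ _ (\sum_(j | j != i) T * expR (- x))).
  apply: ler_sum => j ji; rewrite cmodM cmod_expC.
  have [Sj|/nS ->] := boolP (S j); last first.
    by rewrite cmod0 mul0r mulr_ge0 // expR_ge0.
  rewrite ler_pM ?cmod_ge0 ?expR_ge0 // ler_expR.
  have -> : complex.Re ((P j).[z] - (P i).[z]) = f j - f i.
    by rewrite -ReB hornerD hornerN.
  by have := sep j i ji; rewrite ReB ler0_norm ?subr_le0 ?imax //; lra.
rewrite sumr_const -mulrA -[leLHS]mulr_natl ler_wpM2r ?mulr_ge0 ?expR_ge0 //.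
by rewrite ler_nat max_card.
Qed.

(** Suppose that some coefficient is not identically zero and multiply together
    all rotations of all such coefficients. At each point of large modulus one
    of the factors is exponentially small and the others are of minimal type,
    so the product tends to 0 at infinity and vanishes identically, although
    none of its factors does. *)
Theorem exp_sum_independent (I : finType) (P : I -> {poly R[i]}) (G : I -> C -> C) :
  (forall i j, i != j -> (1 < size (P i - P j)%R)%N) ->
  (forall i, entire (G i)) -> (forall i, minimal_type (G i)) ->
  (forall z, \sum_i G i z * expC (P i).[z] = 0) ->
  forall i z, G i z = 0.
Proof.
move=> hP eG sG sum0 i0 z0; apply: contrapT => /eqP Gi0.
pose S i := `[< exists z, G i z != 0 >].
have Si0 : S i0 by apply/asboolP; exists z0.
have nS i z : ~~ S i -> G i z = 0.
  by move=> /asboolPn Si; apply: contrapT => /eqP Gz; apply: Si; exists z.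
have [m [N [eta [r0 [e0 sep]]]]] := family_rotation_separation hP.
pose rot k z : C := root_minus1 R N ^+ k * z.
have crot k z : cmod (rot k z) = cmod z.
  by rewrite cmodM cmodX cmod_root_minus1 expr1n mul1r.
pose H (p : 'I_m * I) z := G p.2 (rot p.1 z).
have eH p : entire (H p).
  have er := @entireM R (fun=> root_minus1 R N ^+ p.1) id (@entire_cst R _) (@entire_id R).
  exact: (@entire_comp R (G p.2) (rot p.1) (eG _) er).
pose F z := \prod_(p | S p.2) H p z.
have eF : entire F := @entire_prod R _ (fun p => S p.2) H eH.
have [z1] : exists z, F z != 0.
  apply: (@entire_prod_neq0 R _ (fun p => S p.2) H eH) => p /asboolP [w Gw].
  exists (w / root_minus1 R N ^+ p.1).
  by rewrite /H /rot mulrCA divff ?mulr1 // expf_neq0 // -cmod_gt0 cmod_root_minus1.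
suff -> : F z1 = 0 by rewrite eqxx.
apply: (@liouville_zero R F eF) => {z1} eps eps0.
(* The tolerance is chosen so that M factors of minimal type consume only half of
   the decay exp (- eta |z|). *)
pose M := #|{: 'I_m * I}|.+1.
have M0 : 0 < M%:R :> R by rewrite ltr0n.
have d0 : 0 < eta / 2 / M%:R by rewrite !divr_gt0.
have [c cP] := choice (fun i => sG i _ d0).
have [c1 c10 Hc] := fin_upper c.
pose b := c1 + 1.
have b1 : 1 <= b by rewrite /b; lra.
have [A A0 AE] : exists2 A, 0 <= A & A = #|I|%:R * b ^+ M.
  by eexists; last reflexivity; rewrite mulr_ge0 // exprn_ge0 // (le_trans ler01).
exists (`|r0| + 2 * A / (eps * eta)) => z zr.
have q0 : 0 <= 2 * A / (eps * eta) by rewrite divr_ge0 ?mulr_ge0 // ltW.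
have z0r : r0 <= cmod z by have := ler_norm r0; lra.
have zq : 2 * A / (eps * eta) <= cmod z by have := normr_ge0 r0; lra.
have [k Hk] := sep z z0r.
set r := cmod z in zr z0r zq Hk.
have r00 : 0 <= r by exact: cmod_ge0.
pose T := b * expR (eta / 2 / M%:R * r).
have GT i w : cmod w = r -> cmod (G i w) <= T.
  move=> wr; apply: le_trans (cP i w) _; rewrite wr ler_wpM2r ?expR_ge0 //.
  by have := Hc i; rewrite /b; lra.
have T1 : 1 <= T.
  have : expR 0 <= expR (eta / 2 / M%:R * r) by rewrite ler_expR mulr_ge0 // ltW.
  rewrite expR0 => h; rewrite -[1]mulr1 ler_pM //.
have T0 : 0 <= T by exact: le_trans T1.
have er0 : 0 <= eta * r by rewrite mulr_ge0 // ltW.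
have [i Si Gi] := dominant_term_small er0 T0 Hk (fun i => GT i _ (crot k z))
  (sum0 _) Si0 (fun i => @nS i _).
rewrite /F cmod_prod (bigD1 (k, i)) //=.
apply: (@le_trans _ _ (#|I|%:R * T * expR (- (eta * r)) * T ^+ M.-1)).
  apply: ler_pM => //; rewrite ?cmod_ge0 //; first by apply: prodr_ge0 => p _; exact: cmod_ge0.
  apply: (@le_trans _ _ (\prod_(p | S p.2 && (p != (k, i))) T)).
    by apply: ler_prod => p _; rewrite cmod_ge0 GT.
  by rewrite prodr_const ler_weXn2l // max_card.
have -> : #|I|%:R * T * expR (- (eta * r)) * T ^+ M.-1 = A * expR (- (eta * r / 2)).
  transitivity (#|I|%:R * T ^+ M * expR (- (eta * r))); first by rewrite [in RHS]exprS; ring.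
  rewrite /T exprMn -expRM_natl AE -!mulrA -expRD; congr (_ * (_ * expR _)).
  by rewrite -mulr_natl; field; rewrite gt_eqF.
rewrite expRN ler_pdivrMr ?expR_gt0 //.
apply: (@le_trans _ _ (eps * (1 + eta * r / 2))); last first.
  by rewrite ler_wpM2l ?(ltW eps0) // expR_ge1Dx.
rewrite ler_pdivrMr ?mulr_gt0 // in zq; lra.
Qed.

End ExpSum.

(** * Meromorphic coefficients *)

Section Assembly.
Variable R : realType.
Local Notation C := (R[i]^o).
Implicit Types (z w : C).

Lemma minimal_type_cst (c : C) : minimal_type (fun=> c).
Proof.
move=> e e0; exists (cmod c) => z; rewrite -[leLHS]mulr1 ler_wpM2l ?cmod_ge0 //.
by rewrite -expR0 ler_expR mulr_ge0 ?cmod_ge0 // ltW.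
Qed.

Lemma minimal_typeM (f g : C -> C) :
  minimal_type f -> minimal_type g -> minimal_type (fun z => f z * g z).
Proof.
move=> sf sg e e0; have e20 : 0 < e / 2 by rewrite divr_gt0.
have [c Hc] := sf _ e20; have [d Hd] := sg _ e20; exists (c * d) => z.
have -> : c * d * expR (e * cmod z) =
    (c * expR (e / 2 * cmod z)) * (d * expR (e / 2 * cmod z)).
  by rewrite [in LHS](splitr e) mulrDl expRD; ring.
by rewrite cmodM ler_pM ?cmod_ge0.
Qed.

Lemma minimal_type_prod (I : finType) (Q : pred I) (F : I -> C -> C) :
  (forall i, minimal_type (F i)) -> minimal_type (fun z => \prod_(i | Q i) F i z).
Proof.
move=> eF; elim: (index_enum I) => [|i s IH].
  by under eq_fun do rewrite big_nil; exact: minimal_type_cst.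
under eq_fun do rewrite big_cons.
case: (Q i) => /=; last exact: IH.
exact: (@minimal_typeM (F i) (fun z => _) (eF i) IH).
Qed.

(** Some rho < 1 is a growth exponent, and [B * |z| ^ rho <= e * |z|] as soon as
    |z| is at least [(B / e) ^ (1 / (1 - rho))]. *)
Lemma O_lt1_minimal_type (g : C -> C) : O_lt1 g -> minimal_type g.
Proof.
move=> [_ /ereal_inf_lt [_ [rho [rho0 [A [B [A0 B0 gAB]]]] <-]]]; rewrite lte_fin => rho1.
move=> e e0; have q0 : 0 < 1 - rho by rewrite subr_gt0.
pose r1 := (B / e) `^ (1 - rho)^-1.
exists (A * expR (B * r1 `^ rho)) => z.
apply: le_trans (gAB z) _; rewrite -mulrA ler_wpM2l ?(ltW A0) // -expRD ler_expR.
have r10 : 0 <= r1 by exact: powR_ge0.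
have z0 := cmod_ge0 z.
have [zr|zr] := lerP (cmod z) r1.
  apply: (@le_trans _ _ (B * r1 `^ rho)); last by rewrite lerDl mulr_ge0 // ltW.
  by rewrite ler_wpM2l ?(ltW B0) // ge0_ler_powR // ?nnegrE // ltW.
apply: (@le_trans _ _ (e * cmod z)); last by rewrite lerDr mulr_ge0 ?powR_ge0 // ltW.
have zp : 0 < cmod z by exact: le_lt_trans zr.
have zE : cmod z `^ rho * cmod z `^ (1 - rho) = cmod z.
  have rE : rho + (1 - rho) = 1 by ring.
  by rewrite -powRD ?rE ?powRr1 // gt_eqF ?implybT.
rewrite -[in leRHS]zE mulrCA [leLHS]mulrC.
rewrite ler_wpM2l ?powR_ge0 // mulrC -ler_pdivrMr //.
have -> : B / e = r1 `^ (1 - rho).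
  by rewrite /r1 -powRrM mulVf ?gt_eqF // powRr1 // divr_ge0 // ltW.
by rewrite ge0_ler_powR // ?nnegrE // ltW.
Qed.

Lemma fun_class_eq0 (F : C -> C) :
  fun_class F = 0 <-> forall z0 : C, \forall z \near z0^', F z = 0.
Proof.
rewrite -[0](rmorph0 (\pi_({ideal_quot (@codiscretely_zero R)})%qT)).
split => [/eqP|F0].
  by rewrite /fun_class -Quotient.idealrBE subr0 => /codiscretely_zeroP.
apply/eqP; rewrite /fun_class -Quotient.idealrBE subr0; exact/codiscretely_zeroP.
Qed.

Lemma fun_classM (F G : C -> C) :
  fun_class (fun z => F z * G z) = fun_class F * fun_class G.
Proof. exact: (rmorphM (\pi_({ideal_quot (@codiscretely_zero R)})%qT)). Qed.

Lemma fun_classD (F G : C -> C) :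
  fun_class (fun z => F z + G z) = fun_class F + fun_class G.
Proof. exact: (rmorphD (\pi_({ideal_quot (@codiscretely_zero R)})%qT)). Qed.

Lemma fun_class_sum (I : Type) (s : seq I) (F : I -> C -> C) :
  \sum_(i <- s) fun_class (F i) = fun_class (fun z => \sum_(i <- s) F i z).
Proof.
elim: s => [|i s IH].
  rewrite big_nil; apply/esym/fun_class_eq0 => z0.
  by apply: nearW => z; rewrite big_nil.
by under [in RHS]eq_fun do rewrite big_cons; rewrite big_cons IH -fun_classD.
Qed.

Lemma fun_class_prod_exp_poly (I : Type) (s : seq I) (P : I -> {poly R[i]}) (e : I -> nat) :
  \prod_(i <- s) fun_class (exp_poly (P i)) ^+ e i =
  fun_class (exp_poly (\sum_(i <- s) P i *+ e i)).
Proof.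
have exp0 : fun_class (@exp_poly R 0) = 1.
  rewrite -[1](rmorph1 (\pi_({ideal_quot (@codiscretely_zero R)})%qT)).
  by congr (fun_class _); apply/funext => z; rewrite /exp_poly horner0 expC0.
have expD P1 P2 : fun_class (@exp_poly R (P1 + P2)) =
    fun_class (exp_poly P1) * fun_class (exp_poly P2).
  rewrite -fun_classM; congr fun_class; apply/funext => z.
  by rewrite /exp_poly hornerD expCD.
have expX Q n : fun_class (@exp_poly R Q) ^+ n = fun_class (exp_poly (Q *+ n)).
  elim: n => [|n IH]; first by rewrite expr0 mulr0n exp0.
  by rewrite exprS IH -expD mulrS.
elim: s => [|i s IH]; first by rewrite !big_nil exp0.
by rewrite big_cons IH expX -expD big_cons.
Qed.

(** Clearing denominators turns a relation between classes into a relation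
    between entire functions that holds off a discrete set and off the zeros
    of the common denominator; multiplied by that denominator it holds
    everywhere, by the identity theorem, and the denominator may then be
    cancelled because entire functions form an integral domain. *)
Theorem exp_poly_linearly_independent (I : finType) (P : I -> {poly R[i]})
    (c : I -> codiscrete_fun R) :
  (forall i j, i != j -> (1 < size (P i - P j)%R)%N) ->
  (forall i, M_lt1 (c i)) ->
  \sum_i c i * fun_class (exp_poly (P i)) = 0 -> forall i, c i = 0.
Proof.
move=> hP cM.
have [g /choice [h gh]] := choice cM.
have eg i : entire (g i) by have [[]] := gh i.
have eh i : entire (h i) by have [_ []] := gh i.
have sg i : minimal_type (g i) by have [] := gh i => /O_lt1_minimal_type.
have sh i : minimal_type (h i) by have [_ /O_lt1_minimal_type] := gh i.
have h0 i : exists z, h i z != 0.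
  have [_ _ /eqP hi _] := gh i; apply: contrapT => /forallNP hz; apply: hi.
  by apply/funext => z; apply: contrapT => /eqP; apply: hz.
have cE i : c i = fun_class (fun z => g i z / h i z) by have [] := gh i.
pose H z := \prod_i h i z.
pose H' i z := \prod_(j | j != i) h j z.
pose G i z := g i z * H' i z.
have eH : entire H := @entire_prod R I xpredT h eh.
have eH' i : entire (H' i) := @entire_prod R I (fun j => j != i) h eh.
have eG i : entire (G i) := @entireM R (g i) (H' i) (eg i) (eH' i).
have sG i : minimal_type (G i) :=
  @minimal_typeM (g i) (H' i) (sg i) (@minimal_type_prod I (fun j => j != i) h sh).
have eE i : entire (fun z : C => expC (P i).[z]) :=
  @entire_comp R (@expC R) (fun z => (P i).[z]) (@entire_expC R) (@entire_horner R (P i)).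
pose L z := \sum_i G i z * expC (P i).[z].
have eL : entire L.
  exact: (@entire_sum R I xpredT (fun i z => G i z * expC (P i).[z])
    (fun i => @entireM R (G i) (fun z => expC (P i).[z]) (eG i) (eE i))).
under eq_bigr do rewrite cE -fun_classM.
rewrite fun_class_sum => /fun_class_eq0 /(_ 0) sum0 i.
have HL0 : forall z, H z * L z = 0.
  apply: (@identity_dnear R (fun z => H z * L z) 0 (@entireM R H L eH eL)).
  apply: filterS sum0 => z zsum.
  have [->|Hz] := eqVneq (H z) 0; first by rewrite mul0r.
  suff -> : L z = H z * \sum_j g j z / h j z * exp_poly (P j) z.
    by rewrite zsum !mulr0.
  rewrite /L mulr_sumr; apply: eq_bigr => j _.
  have HE : H z = h j z * H' j z by rewrite /H (bigD1 j).
  have hj : h j z != 0 by apply: contraNneq Hz => hj; rewrite HE hj mul0r.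
  rewrite HE /exp_poly mulrA; congr (_ * _).
  by rewrite /G [g j z / _]mulrC mulrACA divff // mul1r mulrC.
have L0 z : L z = 0.
  apply: contrapT => /eqP Lz.
  have H0 : exists z, H z != 0 := @entire_prod_neq0 R I xpredT h eh (fun i _ => h0 i).
  have [w] := @entire_mul_neq0 R H L eH eL H0 (ex_intro _ z Lz).
  by rewrite HL0 eqxx.
have G0 := exp_sum_independent hP eG sG L0 i.
have g0 z : g i z = 0.
  apply: contrapT => /eqP gz.
  have H0 : exists z, H' i z != 0 :=
    @entire_prod_neq0 R I (fun j => j != i) h eh (fun i _ => h0 i).
  have [w] := @entire_mul_neq0 R (g i) (H' i) (eg i) (eH' i) (ex_intro _ z gz) H0.
  by rewrite -/(G i w) G0 eqxx.
rewrite cE; apply/fun_class_eq0 => z0; apply: nearW => z.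
by rewrite g0 mul0r.
Qed.

(** Among the indices where the multiplicities differ, the polynomial of largest
    degree is alone in its degree, so its leading coefficient survives. *)
Lemma size_combination (r : nat) (P : 'I_r -> {poly R[i]}) (m m' : 'I_r -> nat) :
  (forall j, (1 <= (size (P j)).-1)%N) -> injective (fun j => (size (P j)).-1) ->
  (exists j, m j != m' j) ->
  (1 < size (\sum_j P j *+ m j - \sum_j P j *+ m' j)%R)%N.
Proof.
move=> P1 Pinj [j0 mj0].
pose i := [arg max_(i > j0 | m i != m' i) (size (P i)).-1]%N.
have [mi imax] : m i != m' i /\ forall j, m j != m' j ->
    ((size (P j)).-1 <= (size (P i)).-1)%N.
  by rewrite /i; case: arg_maxnP => // j mj jmax.
set Q := (_ - _)%R.
suff Qi : Q`_(size (P i)).-1 != 0.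
  by apply: leq_ltn_trans (P1 i) _; rewrite ltnNge; apply: contra Qi => /leq_sizeP ->.
rewrite /Q -sumrB coef_sum (bigD1 i) //= big1 ?addr0; last first.
  move=> j ji; rewrite coefB !coefMn.
  have [->|/imax mj] := eqVneq (m j) (m' j); first by rewrite subrr.
  have lt : ((size (P j)).-1 < (size (P i)).-1)%N.
    by rewrite ltn_neqAle mj andbT; apply: contra ji => /eqP /Pinj ->.
  rewrite nth_default ?mul0rn ?subrr //.
  by apply: leq_trans lt; exact: leqSpred.
rewrite coefB !coefMn.
have Pi0 : P i != 0 by rewrite -size_poly_gt0; have := P1 i; case: size.
rewrite -lead_coefE -[X in X - _]mulr_natr -[X in _ - X]mulr_natr -mulrBr.
rewrite mulf_neq0 ?lead_coef_eq0 //.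
by rewrite subr_eq0 eqr_nat.
Qed.

End Assembly.


Theorem theorem3p3 (R : realType) (r : nat) (P : 'I_r -> {poly R[i]})
  (hr : (1 <= r)%N)
  (hP : forall j k : 'I_r, j != k -> (1 < size (P j - P k)%R)%N) :
  linearly_independent_over (@M_lt1 R) (fun j => fun_class (exp_poly (P j))) /\
  ((forall j : 'I_r, (1 <= (size (P j)).-1)%N) ->
   injective (fun j : 'I_r => (size (P j)).-1) ->
   algebraically_independent_over (@M_lt1 R)
     (fun j => fun_class (exp_poly (P j)))).
Proof.
split=> [c cM|P1 Pinj p pM].
  exact: exp_poly_linearly_independent.
(* Distinct monomials in the exponentials are exponentials of polynomials with
   non-constant differences, so the first part applies to them. *)
rewrite mevalE; under eq_bigr do rewrite fun_class_prod_exp_poly.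
pose ms (k : 'I_(size (msupp p))) := nth mnm0 (msupp p) k.
rewrite (big_nth mnm0) big_mkord => sum0.
have msP k l : k != l ->
    (1 < size (\sum_i P i *+ (ms k) i - \sum_i P i *+ (ms l) i)%R)%N.
  move=> kl; apply: size_combination => //; apply: contrapT => /forallNP ml.
  move/eqP: kl; apply; apply: val_inj; apply/eqP => /=.
  rewrite -(nth_uniq mnm0 (ltn_ord k) (ltn_ord l) (msupp_uniq p)).
  by apply/eqP/mnmP => j; apply/eqP; apply: contrapT => /negP; apply: ml.
have c0 := exp_poly_linearly_independent msP (fun k => pM (ms k)) sum0.
apply/eqP; rewrite -msupp_eq0; apply: contraT => p0.
have k0 : (0 < size (msupp p))%N by rewrite lt0n size_eq0.
have : ms (Ordinal k0) \in msupp p by rewrite mem_nth.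
by rewrite mcoeff_msupp (c0 (Ordinal k0)) eqxx.
Qed.
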